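(* Let $F=\prod_{i\in I}\mathbb{F}_{q_i}/\mathcal{U}$ be a pseudofinite field and $A=\prod_{i\in I}A_i/\mathcal{U}$ an infinite internal subset of $F$. Suppose there is a positive constant $C$ such that $\{i\in I:|A_i|\le C\log_2 q_i\}\in\mathcal{U}$. Then all internal subsets of $A$ are uniformly definable: there is a formula $\theta(x,\bar y)$ in the language of rings expanded by a unary predicate interpreted as $A$ such that for every internal subset $E\subseteq A$ there is a tuple $\bar c$ from $F$ with $E=\{a\in F:(F,A)\models\theta(a,\bar c)\}$.
   Context: $\mathcal{U}$ is a non-principal ultrafilter on $I$, each $\mathbb{F}_{q_i}$ a finite field, $A_i\subseteq\mathbb{F}_{q_i}$. A subset of $F$ is internal if it is of the form $\prod_{i\in I}E_i/\mathcal{U}$ with $E_i\subseteq\mathbb{F}_{q_i}$. *)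

(* Defs.v *)
From Stdlib Require Import Reals.
From mathcomp Require Import all_boot all_order all_algebra.
From mathcomp Require Import finalg.
Set Implicit Arguments. Unset Strict Implicit. Unset Printing Implicit Defensive.
Import GRing.Theory.
Local Open Scope ring_scope.

Definition is_ultrafilter (I : Type) (U : (I -> Prop) -> Prop) : Prop :=
  [/\ U (fun _ => True),
      ~ U (fun _ => False),
      (forall X Y : I -> Prop, U X -> (forall i, X i -> Y i) -> U Y),
      (forall X Y : I -> Prop, U X -> U Y -> U (fun i => X i /\ Y i)) &
      (forall X : I -> Prop, U X \/ U (fun i => ~ X i))].

Definition nonprincipal (I : Type) (U : (I -> Prop) -> Prop) : Prop :=
  forall i0 : I, ~ U (fun i => i = i0).

(* ---------- The ultraproduct  F = prod_i F_i / U  ----------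
   Elements of F are represented by elements of the full product
   [forall i, F i]; two representatives denote the same element of F iff
   they agree on a U-large set. *)
Section Ultraproduct.
Variables (I : Type) (F : I -> finFieldType) (U : (I -> Prop) -> Prop).

Definition uprod := forall i, F i.

Definition ueq (x y : uprod) : Prop := U (fun i => x i = y i).

Definition uin (E : forall i, {set F i}) (a : uprod) : Prop :=
  U (fun i => a i \in E i).

Definition internal_subset (E A : forall i, {set F i}) : Prop :=
  forall a, uin E a -> uin A a.

Definition internal_infinite (A : forall i, {set F i}) : Prop :=
  ~ exists (n : nat) (f : nat -> uprod),
      forall a, uin A a -> exists k, (k < n)%N /\ ueq a (f k).
End Ultraproduct.

Inductive term : Type :=
  | TVar of nat
  | TZero
  | TOne
  | TAdd of term & term
  | TOpp of term
  | TMul of term & term.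

Inductive formula : Type :=
  | FEq of term & term
  | FP of term
  | FFalse
  | FNot of formula
  | FAnd of formula & formula
  | FOr of formula & formula
  | FImp of formula & formula
  | FEx of nat & formula
  | FAll of nat & formula.

(* ---------- Tarski semantics in the structure (F, A) ----------
   Terms are evaluated coordinatewise on representatives; the equality symbol
   is interpreted as equality of classes (U-a.e. equality), and P as membership
   in the internal set A = prod_i A_i / U.  This is satisfaction in the
   quotient structure F = prod_i F_i / U, computed on representatives. *)
Section Semantics.
Variables (I : Type) (F : I -> finFieldType) (U : (I -> Prop) -> Prop)
          (A : forall i, {set F i}).

Fixpoint teval (e : nat -> uprod F) (t : term) : uprod F :=
  match t with
  | TVar n => e n
  | TZero => fun i => 0
  | TOne => fun i => 1
  | TAdd t1 t2 => fun i => teval e t1 i + teval e t2 i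
  | TOpp t1 => fun i => - teval e t1 i
  | TMul t1 t2 => fun i => teval e t1 i * teval e t2 i
  end.

Definition upd (e : nat -> uprod F) (x : nat) (v : uprod F) : nat -> uprod F :=
  fun n => if n == x then v else e n.

Fixpoint sat (e : nat -> uprod F) (phi : formula) : Prop :=
  match phi with
  | FEq t1 t2 => ueq U (teval e t1) (teval e t2)
  | FP t => uin U A (teval e t)
  | FFalse => False
  | FNot p => ~ sat e p
  | FAnd p q => sat e p /\ sat e q
  | FOr p q => sat e p \/ sat e q
  | FImp p q => sat e p -> sat e q
  | FEx x p => exists v : uprod F, sat (upd e x v) p
  | FAll x p => forall v : uprod F, sat (upd e x v) p
  end.
End Semantics.

(* Environment sending variable 0 to a and variable k+1 to c k:
   this realises the free variables (x, y_1, y_2, ...) of theta(x, ybar). *)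
Definition env_of (I : Type) (F : I -> finFieldType)
    (a : uprod F) (c : nat -> uprod F) : nat -> uprod F :=
  fun n => match n with O => a | S k => c k end.

Definition log2R (n : nat) : R := Rdiv (ln (INR n)) (ln (INR 2)).

(* Main.v *)
Require Import Defs.
From Stdlib Require Import Reals Lra ClassicalEpsilon.
From mathcomp Require Import all_boot all_order all_algebra.
From mathcomp Require Import fingroup morphism pgroup cyclic abelian finfield.
From mathcomp Require Import zify ring.
Set Implicit Arguments. Unset Strict Implicit. Unset Printing Implicit Defensive.
Import Order.TTheory GRing.Theory Num.Theory.
Local Open Scope ring_scope.

(* Write q = |F_i| and n = |A_i|. The infinitude of A forces n -> oo along U, so
   2^n <= q^C', with C' >= C an integer, also makes q larger than any fixed
   polynomial in n.

   If q is odd, let chi be the quadratic character. Stepanov's method bounds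
   sum_t chi(prod_{a in B} (a + t)) by a power of q smaller than 1 times n,
   uniformly over nonempty B in A. Expanding
   prod_{a in A} (1 + eps_a prod_{j<k} chi(a + t_j)) over the subsets of A shows
   that, once k is a large multiple of C', every sign pattern eps on A is
   realised by some t_1, ..., t_k; so every subset of A is cut out by
   "prod_j (x + t_j) is a square".

   If q is even, the additive character psi that is 1 exactly on the values
   y^2 + y replaces chi, with psi(t / (a + s)) in place of chi(a + t): the sum
   over t vanishes unless sum_{a in B} 1/(a + s) = 0, which has fewer than n
   solutions s. *)

(** * Stepanov's method *)

(** Supplies the coefficients of the auxiliary polynomial in Stepanov's method: with more unknowns
    than equations the left kernel is nonzero. *)
Lemma linear_system_nontrivial (K : fieldType) (U V : finType)
    (M : U -> V -> K) :
  (#|V| < #|U|)%N ->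
  exists2 c : U -> K, exists u, c u != 0 &
    forall v, \sum_u c u * M u v = 0.
Proof.
move=> ltVU.
pose N := \matrix_(i < #|U|, j < #|V|) M (enum_val i) (enum_val j).
have kerN0 : kermx N != 0.
  rewrite -mxrank_eq0 mxrank_ker subn_eq0 -ltnNge.
  exact: leq_ltn_trans (rank_leq_col N) ltVU.
set r := nz_row (kermx N).
have r0 : r != 0 by rewrite nz_row_eq0.
have rN : r *m N = 0 by apply/sub_kermxP/nz_row_sub.
exists (fun u => r 0 (enum_rank u)).
  have [i ri] : exists i, r 0 i != 0.
    apply/existsP; apply: contraNT r0; rewrite negb_exists => /forallP r0.
    by apply/eqP/rowP=> i; rewrite mxE; apply/eqP; rewrite -[_ == _]negbK r0.
  by exists (enum_val i); rewrite enum_valK.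
move=> v; move/rowP/(_ (enum_rank v)): rN; rewrite !mxE => rNv; rewrite -[RHS]rNv.
rewrite (reindex_onto (fun i : 'I_#|U| => enum_val i) enum_rank) /=; last first.
  by move=> u _; rewrite enum_rankK.
apply: eq_big => [i|i _]; first by rewrite enum_valK eqxx.
by rewrite mxE enum_valK enum_rankK.
Qed.

(** The cardinality is a power of the characteristic, so raising to it is additive, and it fixes the
    elements of [F]. *)
Lemma poly_exp_card (F : finFieldType) (p : {poly F}) :
  p ^+ #|F| = p \Po 'X^#|F|.
Proof.
have [c pr_c cF] := finPcharP F.
have cq : [pchar {poly F}].-nat #|F|.
  have: c.-nat #|[set: F]| := abelem_pgroup (fin_ring_pchar_abelem cF).
  rewrite cardsT; apply: sub_in_pnat => a _.
  by rewrite inE => /eqP ->; rewrite pchar_poly.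
elim/poly_ind: p => [|p a IHp].
  by rewrite comp_poly0 expr0n; case: #|F| (finNzRing_gt1 F).
by rewrite exprDn_pchar // exprMn IHp comp_polyD comp_polyM comp_polyX comp_polyC
           -rmorphXn /= expf_card.
Qed.

Lemma prod_XsubCX_dvd (K : fieldType) (s : seq K) (l : nat) (p : {poly K}) :
  uniq s -> (forall t, t \in s -> ('X - t%:P) ^+ l %| p) ->
  \prod_(t <- s) ('X - t%:P) ^+ l %| p.
Proof.
elim: s => [|t s IHs] /=; first by rewrite big_nil dvd1p.
case/andP=> tNs Us dvd; rewrite big_cons Gauss_dvdp.
  rewrite dvd ?mem_head // IHs // => u us.
  by apply: dvd; rewrite inE us orbT.
rewrite big_seq; elim/big_rec: _ => [|u r us IHr]; first exact: coprimep1.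
rewrite coprimepMr IHr andbT; apply/coprimep_expl/coprimep_expr.
apply: coprimep_XsubC2; rewrite subr_eq0.
by apply: contraNneq tNs => <-.
Qed.

Lemma mul_card_lt_size (K : finFieldType) (A : {set K}) (l : nat) (p : {poly K}) :
  p != 0 -> (forall t, t \in A -> ('X - t%:P) ^+ l %| p) -> (#|A| * l < size p)%N.
Proof.
move=> p0 dvd.
have szp (s : seq K) : size (\prod_(t <- s) ('X - t%:P) ^+ l) = (size s * l).+1.
  elim: s => [|t s IHs]; first by rewrite big_nil size_poly1.
  rewrite big_cons size_monicM ?monic_exp ?monicXsubC //.
    by rewrite size_exp_XsubC IHs /= addnS mulSn.
  by rewrite -size_poly_eq0 IHs.
have : \prod_(t <- enum A) ('X - t%:P) ^+ l %| p.
  apply: prod_XsubCX_dvd (enum_uniq _) _ => t tA.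
  by apply: dvd; rewrite -mem_enum.
by move/(dvdp_leq p0); rewrite szp -cardE.
Qed.

(* Multiplying [r + s f^e] by its conjugate and by [f] gives [r^2 f - s^2 f^q],
   which is [r^2 f - f(b0) s^2] modulo [(X - b0)^q]. Degrees turn this congruence
   into an equality, contradicting the parity of the multiplicity of [b]. *)
Lemma dvdp_half_power_comb_eq0 (F : finFieldType) (e m D : nat) (f : {poly F}) (b0 b : F)
    (r s : {poly F}) :
  #|F| = e.*2.+1 -> size f = m.+1 -> f.[b0] != 0 -> mup b f = 1%N ->
  (D.*2 + m <= #|F|.+1)%N -> (size r <= D)%N -> (size s <= D)%N ->
  ('X - b0%:P) ^+ #|F| %| r + s * f ^+ e -> r = 0 /\ s = 0.
Proof.
move=> qE szf fb0 mf leD szr szs dvd.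
have f0 : f != 0 by rewrite -size_poly_eq0 szf.
have dvd2 : ('X - b0%:P) ^+ #|F| %| r ^+ 2 * f - f.[b0] *: s ^+ 2.
  have -> : r ^+ 2 * f - f.[b0] *: s ^+ 2 =
      (r + s * f ^+ e) * ((r - s * f ^+ e) * f) + (f ^+ #|F| - f.[b0]%:P) * s ^+ 2.
    have -> : f ^+ #|F| = f * (f ^+ e * f ^+ e).
      by rewrite qE -addnn exprS exprD.
    rewrite -mul_polyC; ring.
  apply: dvdp_add; first exact: dvdp_mulr dvd.
  (* Both q-th powers are compositions with X^q, so this reduces to X - b0 dividing f - f(b0). *)
  apply: dvdp_mulr; rewrite (poly_exp_card f) (poly_exp_card ('X - _)).
  have <- : (f - f.[b0]%:P) \Po 'X^#|F| = f \Po 'X^#|F| - f.[b0]%:P.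
    by rewrite comp_polyB comp_polyC.
  apply: dvdp_comp_poly.
  by rewrite dvdp_XsubCl /root hornerD hornerN hornerC subrr.
have sz0 : r ^+ 2 * f = f.[b0] *: s ^+ 2.
  apply/eqP; rewrite -subr_eq0; apply/negPn/negP => nz.
  have := dvdp_leq nz dvd2; rewrite size_exp_XsubC leqNgt ltnS => /negP; apply.
  apply: leq_trans (size_polyD _ _) _; rewrite size_polyN geq_max.
  have szX (p : {poly F}) : (size p <= D -> size (p ^+ 2)%R <= (D.-1.*2).+1)%N.
    by move=> szp; have := size_poly_exp_leq p 2; lia.
  apply/andP; split.
    have [->|r0] := eqVneq r 0; first by rewrite expr0n mul0r size_poly0.
    have rpos : (0 < size r)%N by rewrite lt0n size_poly_eq0.
    have := size_polyMleq (r ^+ 2) f; have := szX r szr; rewrite szf.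
    by move: (size (r ^+ 2 * f)%R) (size (r ^+ 2)%R) => x y; lia.
  apply: leq_trans (size_scale_leq _ _) _.
  have [->|s0] := eqVneq s 0; first by rewrite expr0n size_poly0.
  have spos : (0 < size s)%N by rewrite lt0n size_poly_eq0.
  have := szX s szs; move: (size (s ^+ 2)%R) => x; lia.
have [s0|s0] := eqVneq s 0.
  split=> //; move: sz0; rewrite s0 expr0n scaler0 => /eqP.
  by rewrite mulf_eq0 (negPf f0) orbF expf_eq0 /= => /eqP.
have [r0|r0] := eqVneq r 0.
  move: sz0; rewrite r0 expr0n mul0r => /esym/eqP.
  by rewrite scaler_eq0 (negPf fb0) expf_eq0 /= (negPf s0).
have := congr1 (mup b) sz0.
rewrite -mul_polyC [RHS]mupMr; last by rewrite rootC.
rewrite !expr2 !mupM ?mulf_neq0 //= mf; lia.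
Qed.

(** This independence makes the auxiliary polynomial nonzero. All terms with j > 0 are multiples of
    (X - b0)^q, so the pair at j = 0 is zero by [dvdp_half_power_comb_eq0]; cancel (X - b0)^q and
    induct on [J]. *)
Lemma half_power_comb_eq0 (F : finFieldType) (e m D J : nat) (f : {poly F}) (b0 b : F)
    (r s : nat -> {poly F}) :
  #|F| = e.*2.+1 -> size f = m.+1 -> f.[b0] != 0 -> mup b f = 1%N ->
  (D.*2 + m <= #|F|.+1)%N ->
  (forall j, (size (r j) <= D)%N) -> (forall j, (size (s j) <= D)%N) ->
  \sum_(j < J) ('X - b0%:P) ^+ (#|F| * j) * (r j + s j * f ^+ e) = 0 ->
  forall j, (j < J)%N -> r j = 0 /\ s j = 0.
Proof.
move=> qE szf fb0 mf leD; elim: J r s => [|J IHJ] r s szr szs //.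
rewrite big_ord_recl /= muln0 expr0 mul1r.
set Y := ('X - b0%:P) ^+ #|F|.
set S := \sum_(j < J) ('X - b0%:P) ^+ (#|F| * j) * (r j.+1 + s j.+1 * f ^+ e).
have -> : \sum_(i < J) ('X - b0%:P) ^+ (#|F| * bump 0 i) *
    (r (bump 0 i) + s (bump 0 i) * f ^+ e) = Y * S.
  rewrite big_distrr /=; apply: eq_bigr => i _.
  by rewrite mulrA -exprD -mulnS.
move=> sum0.
have [r0 s0] : r 0%N = 0 /\ s 0%N = 0.
  apply: (dvdp_half_power_comb_eq0 qE szf fb0 mf leD (szr _) (szs _)).
  have -> : r 0%N + s 0%N * f ^+ e = - (Y * S) by apply/eqP; rewrite -addr_eq0 sum0.
  by rewrite dvdpNr dvdp_mulr.
move: sum0; rewrite r0 s0 mul0r !add0r => /eqP.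
rewrite mulf_eq0 expf_eq0 polyXsubC_eq0 andbF /= => /eqP S0.
by case=> [|j] // ltj; apply: (IHJ (fun j => r j.+1) (fun j => s j.+1)).
Qed.

(* In [{poly {poly F}}] the outer variable is the base point t and the inner one
   is the increment y, so that degrees in t are plain [size]s:
   [taylor_shift f] is f(t + y). *)
Definition taylor_shift (F : fieldType) (f : {poly F}) : {poly {poly F}} :=
  f^:P \Po ('X + 'X%:P).

(* On [f(t)^e = v], [f(t)^l f(t + y)^e] agrees modulo [y^l] with [v] times this
   truncated binomial expansion, whose degree in t does not depend on e. *)
Definition power_jet (F : fieldType) (f : {poly F}) (e l : nat) : {poly {poly F}} :=
  \sum_(i < l) ((f^:P) ^+ (l - i) * (taylor_shift f - f^:P) ^+ i) *+ 'C(e, i).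

Lemma size_taylor_shift (F : fieldType) (f : {poly F}) (m : nat) :
  (size f <= m.+1 -> size (taylor_shift f) <= m.+1)%N.
Proof.
move=> szf; apply: leq_trans (size_comp_poly_leq _ _) _.
rewrite size_map_polyC size_XaddC -[2.-1]/1%N muln1; lia.
Qed.

Lemma size_mul_succ (R : nzRingType) (p q : {poly R}) (a b : nat) :
  (size p <= a.+1 -> size q <= b.+1 -> size (p * q)%R <= (a + b).+1)%N.
Proof. by move=> ? ?; apply: leq_trans (size_polyMleq _ _) _; lia. Qed.

Lemma size_exp_succ (R : nzRingType) (p : {poly R}) (a n : nat) :
  (size p <= a.+1 -> size (p ^+ n)%R <= (a * n).+1)%N.
Proof.
move=> szp; apply: leq_trans (size_poly_exp_leq _ _) _.
by rewrite ltnS leq_mul2r; lia.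
Qed.

Lemma size_power_jet (F : fieldType) (f : {poly F}) (e l m : nat) :
  (size f <= m.+1 -> size (power_jet f e l) <= (m * l).+1)%N.
Proof.
move=> szf; apply: leq_trans (size_sum _ _ _) _; apply/bigmax_leqP => i _.
rewrite -scaler_nat; apply: leq_trans (size_scale_leq _ _) _.
have szP : (size (f^:P) <= m.+1)%N by rewrite size_map_polyC.
have szD : (size (taylor_shift f - f^:P)%R <= m.+1)%N.
  apply: leq_trans (size_polyD _ _) _.
  by rewrite size_polyN geq_max size_taylor_shift.
apply: leq_trans (size_mul_succ (size_exp_succ _ szP) (size_exp_succ _ szD)) _.
by rewrite -mulnDr subnK // ltnW.
Qed.

Lemma horner_taylor_shift (F : fieldType) (f : {poly F}) (t : F) :
  (taylor_shift f).[t%:P] = f \Po ('X + t%:P).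
Proof.
by rewrite /taylor_shift horner_comp hornerD hornerX hornerC addrC.
Qed.

(** Put w = f(t) and expand f(t + y)^e in powers of f(t + y) - w, which y divides: terms with i >= l
    vanish modulo y^l, and for i < l the identity w^l w^(e-i) = w^e w^(l-i) matches the jet. *)
Lemma power_jetP (F : fieldType) (f : {poly F}) (e l : nat) (t : F) :
  (l <= e.+1)%N ->
  'X^l %| f.[t] ^+ l *: (f ^+ e \Po ('X + t%:P))
          - f.[t] ^+ e *: (power_jet f e l).[t%:P].
Proof.
move=> le_le.
set w := f.[t]; set ft := f \Po ('X + t%:P).
have fP : (f^:P).[t%:P] = w%:P by rewrite horner_map.
have XD : 'X %| ft - w%:P.
  have -> : ft - w%:P = (f - w%:P) \Po ('X + t%:P).
    by rewrite comp_polyB comp_polyC.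
  have XE : ('X - t%:P) \Po ('X + t%:P) = 'X.
    by rewrite comp_polyB comp_polyX comp_polyC addrK.
  by rewrite -[X in X %| _]XE dvdp_comp_poly // dvdp_XsubCl /root hornerD hornerN hornerC subrr.
have -> : (power_jet f e l).[t%:P] =
    \sum_(i < l) (w%:P ^+ (l - i) * (ft - w%:P) ^+ i) *+ 'C(e, i).
  rewrite horner_sum; apply: eq_bigr => i _.
  by rewrite hornerMn hornerM !horner_exp hornerD hornerN horner_taylor_shift fP.
have -> : f ^+ e \Po ('X + t%:P) =
    \sum_(0 <= i < e.+1) (w%:P ^+ (e - i) * (ft - w%:P) ^+ i) *+ 'C(e, i).
  by rewrite rmorphXn /= -/ft -{1}[ft](subrK w%:P) addrC exprDn big_mkord.
rewrite -(big_mkord xpredT (fun i => (w%:P ^+ (l - i) * (ft - w%:P) ^+ i) *+ 'C(e, i))).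
rewrite (@big_cat_nat _ _ _ l) //= scalerDr addrAC !scaler_sumr -sumrB.
rewrite big_nat big1 => [|i /andP[_ lti]].
  rewrite add0r big_nat; apply: (big_ind (fun p => 'X^l %| p)) => [|p q|i /andP[lei _]].
  - exact: dvdp0.
  - exact: dvdp_add.
  rewrite -mul_polyC -mulr_natr; apply/dvdp_mull/dvdp_mulr/dvdp_mull.
  by apply: dvdp_trans (dvdp_exp2l _ lei) _; apply: dvdp_exp2r.
apply/eqP; rewrite subr_eq0 -!mul_polyC !rmorphXn /= !mulrnAr !mulrA -!exprD.
by apply/eqP; congr (_ ^+ _ * _ *+ _); lia.
Qed.

Definition stepanov_poly (F : finFieldType) (e : nat) (f : {poly F}) (b0 : F)
    (b : bool) (j i : nat) : {poly F} :=
  ('X - b0%:P) ^+ (#|F| * j) * ('X^i * (if b then f ^+ e else 1)).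

(** This is f(t)^l times [stepanov_poly] at t + y, modulo y^l, when f(t)^e = v. Since t^q = t, (t +
    y - b0)^q = y^q + t - b0, so for l <= q the factor (X - b0)^(qj) shrinks to degree j in t. This
    saving leaves fewer equations than unknowns. *)
Definition stepanov_jet (F : finFieldType) (e l : nat) (f : {poly F}) (b0 v : F)
    (b : bool) (j i : nat) : {poly {poly F}} :=
  ('X - b0%:P%:P) ^+ j *
  (('X + 'X%:P) ^+ i * (if b then v%:P *: power_jet f e l else (f^:P) ^+ l)).

Lemma size_stepanov_jet (F : finFieldType) (e l m : nat) (f : {poly F}) (b0 v : F)
    (b : bool) (j i : nat) :
  (size f <= m.+1 -> size (stepanov_jet e l f b0 v b j i) <= (j + (i + m * l)).+1)%N.
Proof.
move=> szf; apply: size_mul_succ; first by rewrite size_exp_XsubC.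
apply: size_mul_succ.
  by rewrite -[X in (_ <= X.+1)%N]mul1n; apply: size_exp_succ; rewrite size_XaddC.
case: b; last by apply: size_exp_succ; rewrite size_map_polyC.
exact: leq_trans (size_scale_leq _ _) (size_power_jet _ _ szf).
Qed.

Lemma dvdp_subM (K : fieldType) (d p p' q q' : {poly K}) :
  d %| p - p' -> d %| q - q' -> d %| p * q - p' * q'.
Proof.
move=> dp dq.
have -> : p * q - p' * q' = (p - p') * q + p' * (q - q') by ring.
by apply: dvdp_add; [apply: dvdp_mulr | apply: dvdp_mull].
Qed.

Lemma stepanov_jetP (F : finFieldType) (e l : nat) (f : {poly F}) (b0 v t : F)
    (b : bool) (j i : nat) :
  (l <= e.+1)%N -> (l <= #|F|)%N -> f.[t] ^+ e = v ->
  'X^l %| f.[t] ^+ l *: (stepanov_poly e f b0 b j i \Po ('X + t%:P))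
          - (stepanov_jet e l f b0 v b j i).[t%:P].
Proof.
move=> lee leq ftv.
rewrite /stepanov_poly /stepanov_jet !comp_polyM !hornerM !horner_exp.
rewrite -(mul_polyC (f.[t] ^+ l)) mulrCA; apply: dvdp_subM; last first.
  rewrite mulrCA; apply: dvdp_subM.
    by rewrite rmorphXn /= comp_polyX hornerD hornerX hornerC [t%:P + _]addrC subrr dvdp0.
  case: b; first by rewrite hornerZ -ftv rmorphXn /= -rmorphXn /= !mul_polyC power_jetP.
  by rewrite -[1]/1%:P comp_polyC mulr1 horner_exp horner_map /= rmorphXn /= subrr dvdp0.
rewrite rmorphXn /= !hornerE comp_polyB comp_polyX comp_polyC exprM.
rewrite subrXX; apply: dvdp_mulr.
rewrite poly_exp_card comp_polyB comp_polyD !comp_polyC comp_polyX.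
have -> : 'X^#|F| + t%:P - b0%:P - (t%:P - b0%:P) = 'X^#|F| :> {poly F} by ring.
exact: dvdp_exp2l.
Qed.

Lemma dvdp_Xn (K : fieldType) (n : nat) (p : {poly K}) :
  (forall k, (k < n)%N -> p`_k = 0) -> 'X^n %| p.
Proof.
move=> p0; rewrite -(poly_take_drop n p).
have -> : take_poly n p = 0.
  by apply/polyP => k; rewrite coef_take_poly coef0; case: ifP => // /p0.
by rewrite add0r dvdp_mull.
Qed.

(** The 2(J+1)(D+1) coefficients [c] outnumber the monomials y^k t^d with k < l that occur in the
    jets. Killing all of these in the combination makes [Psi] vanish to order l at every t with
    f(t)^e = v. As [Psi] is nonzero by [half_power_comb_eq0], its degree bounds the number of such
    t. *)
Lemma stepanov_count (F : finFieldType) (e m J D l : nat) (f : {poly F}) (b0 b v : F) :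
  #|F| = e.*2.+1 -> size f = m.+1 -> f.[b0] != 0 -> mup b f = 1%N -> v != 0 ->
  (D.+1.*2 + m <= #|F|.+1)%N -> (l <= e.+1)%N -> (0 < e)%N ->
  (l * (J + (D + m * l)).+1 < 2 * J.+1 * D.+1)%N ->
  (#|[set t | f.[t] ^+ e == v]| * l <= #|F| * J + (D + m * e))%N.
Proof.
move=> qE szf fb0 mf v0 leD lee e0 ltU.
have leq : (l <= #|F|)%N by lia.
pose Ix : finType := (bool * 'I_J.+1 * 'I_D.+1)%type.
pose M := (J + (D + m * l)).+1.
pose Eq : finType := ('I_l * 'I_M)%type.
pose jet (u : Ix) := stepanov_jet e l f b0 v u.1.1 u.1.2 u.2.
pose P (u : Ix) := stepanov_poly e f b0 u.1.1 u.1.2 u.2.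
have ltEq : (#|Eq| < #|Ix|)%N by rewrite !card_prod !card_ord card_bool.
have [c [u0 cu0] cM] := linear_system_nontrivial
  (fun u (w : Eq) => (jet u)`_(w.2)`_(w.1)) ltEq.
pose Psi : {poly F} := \sum_u c u *: P u.
have Psi_dvd t : t \in [set t | f.[t] ^+ e == v] -> ('X - t%:P) ^+ l %| Psi.
  rewrite inE => /eqP ftv.
  (* Needed to cancel the factor f(t)^l that the jets carry. *)
  have ft0 : f.[t] != 0.
    by apply: contraNneq v0 => ft0; rewrite -ftv ft0 expr0n -[e]prednK.
  have Q0 : 'X^l %| \sum_u c u *: (jet u).[t%:P].
    apply: dvdp_Xn => k ltk; rewrite coef_sum.
    have coef_jetE u : (c u *: (jet u).[t%:P])`_k =
        \sum_(d < M) t ^+ d * (c u * (jet u)`_d`_k).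
      rewrite coefZ (@horner_coef_wide _ M) ?coef_sum ?big_distrr /=.
        by apply: eq_bigr => d _; rewrite -rmorphXn /= coefMC; ring.
      apply: leq_trans (size_stepanov_jet (m := m) _ _ _ _ _ _ _ _) _; first by rewrite szf.
      move: (ltn_ord u.1.2) (ltn_ord u.2); rewrite /M !ltnS => ? ?.
      by rewrite leq_add ?leq_add2r.
    rewrite (eq_bigr _ (fun u _ => coef_jetE u)) exchange_big big1 //= => d _.
    by rewrite -big_distrr /= (cM (Ordinal ltk, d)) mulr0.
  have : 'X^l %| f.[t] ^+ l *: (Psi \Po ('X + t%:P)).
    rewrite -(dvdp_subl _ Q0) (raddf_sum (comp_poly _)) scaler_sumr -sumrB.
    apply: (big_ind (fun p => 'X^l %| p)) => [|p p'|u _]; first exact: dvdp0.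
      exact: dvdp_add.
    rewrite /= -![c u *: _]mul_polyC comp_polyM comp_polyC -mul_polyC mulrCA -mulrBr.
    by rewrite dvdp_mull // mul_polyC stepanov_jetP.
  rewrite dvdpZr ?expf_neq0 // => /(dvdp_comp_poly ('X - t%:P)).
  by rewrite -comp_polyA rmorphXn /= comp_polyD !comp_polyX comp_polyC subrK comp_polyXr.
pose r b j := \poly_(i < D.+1) c (b, inord j, inord i).
have PsiE : Psi = \sum_(j < J.+1)
    ('X - b0%:P) ^+ (#|F| * j) * (r false j + r true j * f ^+ e).
  have -> : Psi = \sum_b \sum_j \sum_i c (b, j, i) *: P (b, j, i).
    rewrite pair_bigA pair_bigA; apply: eq_bigr => -[[b' j] i] _ //.
  rewrite exchange_big /=; apply: eq_bigr => j _.
  rewrite big_bool /= addrC mulrDr; congr (_ + _).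
    rewrite /r poly_def big_distrr /=; apply: eq_bigr => i _.
    by rewrite /P /stepanov_poly /= mulr1 !inord_val scalerAr.
  rewrite /r poly_def big_distrl big_distrr /=; apply: eq_bigr => i _.
  by rewrite /P /stepanov_poly /= !inord_val -!scalerAl scalerAr.
have szr b' j : (size (r b' j) <= D.+1)%N by exact: size_poly.
have Psi0 : Psi != 0.
  apply: contra cu0; rewrite PsiE => /eqP Psi0.
  have [rj sj] := half_power_comb_eq0 qE szf fb0 mf leD (szr false) (szr true) Psi0 (ltn_ord u0.1.2).
  have : (r u0.1.1 u0.1.2)`_u0.2 = 0.
    by case: (u0.1.1); rewrite ?rj ?sj coef0.
  by rewrite coef_poly ltn_ord !inord_val; case: (u0) => [[? ?] ?] /= ->.
have lt_size := mul_card_lt_size Psi0 Psi_dvd.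
rewrite -ltnS; apply: leq_trans lt_size _.
rewrite PsiE; apply: leq_trans (size_sum _ _ _) _; apply/bigmax_leqP => j _.
apply: (@leq_trans (#|F| * j + (D + m * e)).+1); last first.
  by rewrite ltnS leq_add2r leq_mul2l -ltnS ltn_ord orbT.
apply: size_mul_succ; first by rewrite size_exp_XsubC.
apply: leq_trans (size_polyD _ _) _; rewrite geq_max.
rewrite (leq_trans (szr _ _)) ?ltnS ?leq_addr //=.
by apply: size_mul_succ (szr _ _) _; apply: size_exp_succ; rewrite szf.
Qed.

(** * Realising sign patterns *)

(** If no tuple in D^k realises [E], every product over A of 1 + eps_a prod_j h(a, t_j) is zero.
    Expand the sum of these products over the subsets B of A: the empty set contributes |D|^k and
    every other B at most beta^k in absolute value, against the size hypothesis. *)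
Lemma sign_patterns (X T : finType) (A E : {set X}) (D : {set T})
    (h : X -> T -> int) (k beta : nat) :
  (forall a t, a \in A -> t \in D -> h a t = 1 \/ h a t = -1) ->
  (forall B : {set X}, B \subset A -> B != set0 ->
     `|\sum_(t in D) \prod_(a in B) h a t| <= beta%:Z) ->
  (2 ^ #|A| * beta ^ k < #|D| ^ k)%N ->
  exists2 t : {ffun 'I_k -> T}, forall j, t j \in D &
    forall a, a \in A -> (a \in E) = (\prod_j h a (t j) == 1).
Proof.
move=> h1 hB ltk.
have [/existsP[t /andP[/forallP tD /forall_inP tE]]|noT] :=
    boolP [exists t : {ffun 'I_k -> T}, [forall j, t j \in D] &&
      [forall (a | a \in A), (a \in E) == (\prod_j h a (t j) == 1)]].
  by exists t => // a /tE/eqP.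
have prod1 a (t : {ffun 'I_k -> T}) : a \in A -> (forall j, t j \in D) ->
    \prod_j h a (t j) = 1 \/ \prod_j h a (t j) = -1.
  move=> aA tD; apply: (big_ind (fun x : int => x = 1 \/ x = -1)) => [|x y|j _].
  - by left.
  - by case=> ->; case=> ->; rewrite ?mul1r ?mulr1 ?mulrNN; auto.
  - exact: h1.
pose eps a : int := if a \in E then 1 else -1.
(* Zero outside [A], so that the expansion over all subsets of [X] keeps only those inside [A]. *)
pose x (t : {ffun 'I_k -> T}) a := if a \in A then eps a * \prod_j h a (t j) else 0.
pose S (B : {set X}) : int := \sum_(t in D) \prod_(a in B) h a t.
have sum0 : \sum_(t in ffun_on (mem D)) \prod_a (x t a + 1) = 0.
  apply: big1 => t /ffun_onP tD.
  have : ~~ [forall (a | a \in A), (a \in E) == (\prod_j h a (t j) == 1)].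
    have /existsPn/(_ t) := noT; rewrite negb_and => /orP[|//].
    by case/forallPn=> j; rewrite tD.
  case/forallPn=> a; rewrite negb_imply => /andP[aA nE].
  rewrite (bigD1 a) //= /x aA /eps.
  suff -> : (if a \in E then 1 else -1) * \prod_j h a (t j) = -1 :> int.
    by rewrite [X in X * _](_ : _ = 0) ?mul0r.
  case: (prod1 a t aA tD) nE => ->; case: (a \in E); rewrite ?eqxx ?mul1r ?mulr1 //.
have sumE : \sum_(t in ffun_on (mem D)) \prod_a (x t a + 1) =
    \sum_(B : {set X} | B \subset A) (\prod_(a in B) eps a) * S B ^+ k.
  under eq_bigr => t _ do rewrite bigA_distr.
  rewrite exchange_big (bigID (fun B : {set X} => B \subset A)) /=.
  rewrite [X in _ + X]big1 ?addr0 => [|B /subsetPn[a aB aA]]; last first.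
    by apply: big1 => t _; rewrite (bigD1 a) //= aB /x (negPf aA) mul0r.
  apply: eq_bigr => B sBA.
  have -> : S B ^+ k = \sum_(t : {ffun 'I_k -> T} | t \in ffun_on (mem D)) \prod_j \prod_(a in B) h a (t j).
    rewrite -(card_ord k) -prodr_const /S card_ord.
    by rewrite (bigA_distr_big (mem D) (fun _ t => \prod_(a in B) h a t)).
  rewrite big_distrr /=; apply: eq_bigr => t _.
  rewrite exchange_big -big_split /= [RHS]big_mkcond /=.
  apply: eq_bigr => a _; case: ifP => // aB.
  by rewrite /x (subsetP sBA).
have eps1 a : `|eps a| = 1 by rewrite /eps; case: ifP.
have : (#|D| ^ k)%:Z <= (2 ^ #|A| * beta ^ k)%:Z.
  move: sumE; rewrite sum0 (bigD1 set0) ?sub0set //= big_set0 mul1r /S.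
  under [X in X ^+ k]eq_bigr => t _ do rewrite big_set0.
  rewrite sumr_const => /esym/eqP; rewrite addr_eq0 => /eqP Dk.
  have -> : (#|D| ^ k)%:Z = `|(1 *+ #|D|) ^+ k : int|.
    by rewrite -natz natrX ger0_norm ?exprn_ge0.
  rewrite Dk normrN; apply: le_trans (ler_norm_sum _ _ _) _.
  apply: (@le_trans _ _ (\sum_(B : {set X} | B \subset A) (beta%:Z) ^+ k)).
    rewrite [X in _ <= X](bigD1 set0) ?sub0set //= ler_wpDl ?exprn_ge0 //.
    apply: ler_sum => B /andP[sBA B0].
    rewrite normrM normr_prod big1 ?mul1r; last by move=> a _; exact: eps1.
    by rewrite normrX lerXn2r ?nnegrE //; exact: hB.
  rewrite sumr_const.
  have -> : #|[pred B : {set X} | B \subset A]| = (2 ^ #|A|)%N.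
    by rewrite -card_powerset; apply: eq_card => B; rewrite !inE.
  by rewrite -mulr_natl -!natz natrM [(beta ^ k)%:R]natrX.
by rewrite lez_nat leqNgt ltk.
Qed.

(** * Odd characteristic: the quadratic character and its sums *)

Lemma euler_criterion (F : finFieldType) (e : nat) (z : F) :
  #|F| = e.*2.+1 -> (0 < e)%N -> z ^+ e = 1 -> exists y, y ^+ 2 = z.
Proof.
move=> qE e0 ze.
have Uz : z \is a GRing.unit.
  rewrite unitfE; apply: contra_eq_neq ze => ->.
  by rewrite expr0n -[e]prednK // eq_sym oner_neq0.
have /cyclicP[g gE] := field_unit_group_cyclic [set: {unit F}].
have og : #[g]%g = e.*2.
  by rewrite /order -gE card_finField_unit qE.
pose u : {unit F} := FinRing.unit F Uz.
have /cycleP[i ui] : u \in <[g]>%g by rewrite -gE inE.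
have : (u ^+ e)%g = 1%g by apply: val_inj; rewrite FinRing.val_unitX /= ze.
(* The generator g has order 2e and u = g^i, so u^e = 1 forces 2e to divide ie, and i is even. *)
rewrite ui -expgM => /eqP; rewrite -order_dvdn og -mul2n dvdn_pmul2r //.
case/dvdnP=> j ij; exists (val g ^+ j).
by rewrite -exprM -ij -FinRing.val_unitX -ui.
Qed.

(* The junk value at 0 is -1. *)
Definition qchar (F : finFieldType) (e : nat) (z : F) : int :=
  if z ^+ e == 1 then 1 else -1.

Lemma exp_half_card (F : finFieldType) (e : nat) (z : F) :
  #|F| = e.*2.+1 -> z != 0 -> z ^+ e = 1 \/ z ^+ e = -1.
Proof.
move=> qE z0.
have : (z ^+ e) ^+ 2 == 1.
  rewrite -exprM muln2; apply/eqP/(mulfI z0).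
  by rewrite -exprS -qE expf_card mulr1.
by rewrite sqrf_eq1 => /orP[/eqP|/eqP]; auto.
Qed.

(** If -1 = 1 then 2 = 0, while q = 2e + 1 is zero in [F]; hence 1 = 0. *)
Lemma odd_card_oneN (F : finFieldType) (e : nat) :
  #|F| = e.*2.+1 -> -1 != 1 :> F.
Proof.
move=> qE; apply/eqP => N1.
have two0 : 1 + 1 = 0 :> F by rewrite -{1}N1 addNr.
have qF : #|F|%:R = 0 :> F.
  have [c pr_c cF] := finPcharP F.
  have: c.-nat #|[set: F]| := abelem_pgroup (fin_ring_pchar_abelem cF).
  rewrite cardsT => /p_natP[n nE].
  have n0 : (0 < n)%N.
    by rewrite lt0n; apply: contraTneq (finNzRing_gt1 F) => n0; rewrite nE n0.
  by rewrite nE natrX (pcharf0 cF) expr0n -[n]prednK.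
move/eqP: qF; rewrite qE -addn1 natrD -muln2 natrM -[2%:R]/(1 + 1) two0 mulr0.
by rewrite add0r oner_eq0.
Qed.

Lemma qcharM (F : finFieldType) (e : nat) (y z : F) :
  #|F| = e.*2.+1 -> y != 0 -> z != 0 -> qchar e (y * z) = qchar e y * qchar e z.
Proof.
move=> qE y0 z0; have N1 := odd_card_oneN qE; rewrite /qchar exprMn.
by case: (exp_half_card qE y0) => ->; case: (exp_half_card qE z0) => ->;
  rewrite ?mul1r ?mulr1 ?mulrNN ?mul1r ?eqxx ?(negPf N1).
Qed.

Lemma qchar_prod (F : finFieldType) (e : nat) (I : finType) (P : pred I) (g : I -> F) :
  #|F| = e.*2.+1 -> (forall i, P i -> g i != 0) ->
  qchar e (\prod_(i | P i) g i) = \prod_(i | P i) qchar e (g i).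
Proof.
move=> qE g0.
suff [] : qchar e (\prod_(i | P i) g i) = \prod_(i | P i) qchar e (g i) /\
          \prod_(i | P i) g i != 0 by [].
elim/big_rec2: _ => [|i y z Pi [<- z0]].
  by rewrite /qchar expr1n eqxx oner_neq0.
by rewrite qcharM ?g0 // mulf_neq0 ?g0.
Qed.

Lemma qcharP (F : finFieldType) (e : nat) (z : F) :
  #|F| = e.*2.+1 -> (0 < e)%N -> z != 0 ->
  reflect (exists y, y ^+ 2 = z) (qchar e z == 1).
Proof.
move=> qE e0 z0; rewrite /qchar; case: (eqVneq (z ^+ e) 1) => [ze|ze].
  by rewrite eqxx; apply: ReflectT; exact: euler_criterion qE e0 ze.
apply: ReflectF => -[y yz]; case/eqP: ze.
have y0 : y != 0 by apply: contraNneq z0 => y0; rewrite -yz y0 expr0n.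
by rewrite -yz -exprM mul2n; apply/(mulfI y0); rewrite -exprS -qE expf_card mulr1.
Qed.

Lemma card_avoid_opp (F : finFieldType) (A : {set F}) :
  (#|F| - #|A| <= #|[set t | [forall (a | a \in A), (a + t)%R != 0%R]]|)%N.
Proof.
set D := [set t | _].
rewrite leq_subLR -(cardsC D) addnC leq_add2r.
have -> : ~: D = [set - a | a in A].
  apply/setP => t; rewrite !inE; apply/forallPn/imsetP => [[a]|[a aA ->]].
    rewrite negb_imply negbK => /andP[aA at0]; exists a => //.
    by apply/eqP; rewrite -addr_eq0 addrC.
  by exists a; rewrite aA subrr eqxx.
exact: leq_imset_card.
Qed.

(** The polynomial f = prod_{a in B} (X + a) has simple roots, and the sum is N_1 - N_{-1}, where
    N_v counts the t in D with f(t)^e = v. Stepanov's method bounds each N_v by q/2 + q(|B| +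
    1)/(4h), while N_1 + N_{-1} = |D| >= q - |A|. The parameter h is fixed in [odd_patterns]. *)
Lemma qchar_sum_bound (F : finFieldType) (e h : nat) (A B : {set F}) :
  #|F| = e.*2.+1 -> B \subset A -> B != set0 -> (0 < h)%N ->
  (2 * h * h * (1 + 2 * #|A|) + #|A| + 2 <= #|F|)%N ->
  `|\sum_(t in [set t | [forall (a | a \in A), a + t != 0]])
      \prod_(a in B) qchar e (a + t)| <= (#|F| * #|A|.+1 %/ h)%:Z.
Proof.
move=> qE sBA B0 h0 leq.
pose f := \prod_(a in B) ('X - (- a)%:P).
set D := [set t | _].
have hf t : f.[t] = \prod_(a in B) (a + t).
  by rewrite horner_prod; apply: eq_bigr => a _; rewrite hornerXsubC opprK addrC.
have leBA : (#|B| <= #|A|)%N := subset_leq_card sBA.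
have leq2 : (#|A| + 2 <= #|F|)%N by apply: leq_trans leq; rewrite -addnA leq_addl.
have e0 : (0 < e)%N by lia.
have szf : size f = #|B|.+1.
  by rewrite /f -big_enum size_prod_XsubC -cardE.
have [b bB] := set0Pn _ B0.
have mf : mup (- b) f = 1%N.
  rewrite /f (bigD1 b) //= mupMl ?(mup_XsubCX 1) ?eqxx //.
  rewrite /root horner_prod; apply/prodf_neq0 => a /andP[_ ab].
  by rewrite hornerXsubC opprK addrC subr_eq0.
have [b0 fb0] : exists b0, f.[b0] != 0.
  apply/existsP; apply: contraT => /existsPn roots.
  have f0 : f != 0 by rewrite -size_poly_eq0 szf.
  have allr : all (root f) (enum F).
    by apply/allP => t _; have := roots t; rewrite negbK.
  have := max_poly_roots f0 allr (enum_uniq F); rewrite szf -cardE => ltF.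
  have le2 : (#|A| + 2 <= #|B|)%N := leq_trans leq2 ltF.
  have : (#|A| + 2 <= #|A|)%N := leq_trans le2 leBA.
  by rewrite addnC ltnNge leqnSn.
have f_nz : forall t, t \in D -> f.[t] != 0.
  move=> t; rewrite inE hf => /forall_inP tD.
  by apply/prodf_neq0 => a aB; apply: tD; apply: (subsetP sBA).
have N1 := odd_card_oneN qE.
have sumE : \sum_(t in D) \prod_(a in B) qchar e (a + t) =
   #|[set t in D | f.[t] ^+ e == 1]|%:Z - #|[set t in D | f.[t] ^+ e == -1]|%:Z.
  have -> : \sum_(t in D) \prod_(a in B) qchar e (a + t) =
      \sum_(t in D) ((f.[t] ^+ e == 1)%:R - (f.[t] ^+ e == -1)%:R).
    apply: eq_bigr => t tD; rewrite -qchar_prod // => [|a aB].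
      rewrite -hf /qchar.
      case: (exp_half_card qE (f_nz t tD)) => ->.
        by rewrite eqxx eq_sym (negPf N1) subr0.
      by rewrite eqxx (negPf N1) sub0r.
    by move: tD; rewrite inE => /forall_inP; apply; apply: (subsetP sBA).
  rewrite sumrB -!natr_sum -!big_mkcondr !sum1_card !natz.
  by congr (Posz _ - Posz _); apply: eq_card => t; rewrite [RHS]inE.
have cardD : #|D| =
    (#|[set t in D | (f.[t] ^+ e == 1)%R]| + #|[set t in D | (f.[t] ^+ e == -1)%R]|)%N.
  rewrite -(cardsID [set t | f.[t] ^+ e == 1] D); congr (_ + _)%N.
    by apply: eq_card => t; rewrite in_setI [RHS]inE; congr (_ && _); rewrite inE.
  apply: eq_card => t; rewrite in_setD [RHS]inE andbC.
  rewrite [t \in [set t | _ == 1]]inE.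
  case tD: (t \in D) => //=.
  by case: (exp_half_card qE (f_nz t tD)) => ->; rewrite ?eqxx //
    1?eq_sym ?(negPf N1) 1?eq_sym ?(negPf N1).
have geD : (#|F| - #|A| <= #|D|)%N := card_avoid_opp A.
have bound (v : F) : v != 0 ->
    (4 * h * #|[set t in D | f.[t] ^+ e == v]| <= 2 * #|F| * h + #|F| * #|B|.+1)%N.
  (* The method is run with J = h, l = 2h and D = d. Unknowns outnumber equations exactly when h^2
     (1 + 2|B|) < d + 1, and d + 1 is about (q - |B|)/2, the most that independence allows. *)
  move=> v0; pose d := ((#|F| - #|B|)./2.-1)%N.
  have dE : (d.+1.*2 + #|B| <= #|F|.+1)%N by rewrite /d; lia.
  have dE' : (#|F| <= d.+1.*2 + #|B|.+1)%N by rewrite /d; lia.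
  have lee : (2 * h <= e.+1)%N by nia.
  have cnt : (2 * h * (h + (d + #|B| * (2 * h))).+1 < 2 * h.+1 * d.+1)%N.
    by nia.
  have bnd := stepanov_count qE szf fb0 mf v0 dE lee e0 cnt.
  have sub : (#|[set t in D | f.[t] ^+ e == v]| * (2 * h) <=
              #|[set t | f.[t] ^+ e == v]| * (2 * h))%N.
    rewrite leq_mul2r subset_leq_card ?orbT //.
    by apply/subsetP => t; rewrite !inE => /andP[].
  have me : (2 * (#|B| * e) <= #|F| * #|B|)%N by rewrite qE; lia.
  have d2 : (2 * d <= #|F|)%N by rewrite /d; lia.
  have := leq_trans sub bnd; move: (#|[set t in D | f.[t] ^+ e == v]|) => N.
  move: me d2; rewrite mulnS; lia.
rewrite sumE.
have N10 : -1 != 0 :> F by rewrite oppr_eq0 oner_neq0.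
move: (bound 1 (oner_neq0 _)) (bound (-1) N10) cardD.
move: #|[set t in D | f.[t] ^+ e == 1]| #|[set t in D | f.[t] ^+ e == -1]| => x y.
move=> bx bny cardD.
(* Write x - y as 2x - (x + y). Subtraction is truncated, so this is applied in both orders. *)
have key (x1 y1 : nat) : (4 * h * x1 <= 2 * #|F| * h + #|F| * #|B|.+1)%N ->
    (#|F| - #|A| <= x1 + y1)%N -> (x1 - y1 <= #|F| * #|A|.+1 %/ h)%N.
  rewrite leq_divRL //; move: #|F| #|A| #|B| leBA leq leq2 {qE bx bny cardD geD} => q n m lemn leq leq2.
  move=> bx1 ge1.
  have hq : (2 * h <= q)%N by nia.
  have : (2 * (h * q) <= 2 * (h * (x1 + y1)) + 2 * h * n)%N by nia.
  have : (q * m.+1 <= q * n.+1)%N by rewrite leq_mul2l ltnS lemn orbT.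
  have : (2 * h * n <= q * n.+1)%N by nia.
  nia.
move: geD; rewrite cardD => geD.
have := key x y bx geD; have := key y x bny; rewrite addnC => /(_ geD).
case: (leqP x y) => [lexy|/ltnW leyx].
  by rewrite distrC subzn // ger0_norm.
by rewrite subzn // ger0_norm.
Qed.

Lemma cube_root (q : nat) : exists2 h, (h ^ 3 <= q)%N & (q < h.+1 ^ 3)%N.
Proof.
have ex : exists h, (h ^ 3 <= q)%N by exists 0%N.
have ub h : (h ^ 3 <= q)%N -> (h <= q)%N.
  by apply: leq_trans; rewrite !expnS expn0; nia.
case: (ex_maxnP ex ub) => h hq hmax; exists h => //.
by rewrite ltnNge; apply: contraL (ltnSn h); rewrite -leqNgt; apply: hmax.
Qed.

(** Take for h the integer cube root of q: then h^2 |A| is small against q, and h >= 8(|A| + 1)^2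
    because 512 = 8^3. [sign_patterns] applies with |D| >= q/2, beta = q(|A| + 1)/h and 6C
    shifts. *)
Lemma odd_patterns (F : finFieldType) (A E : {set F}) (C : nat) :
  odd #|F| -> (0 < C)%N -> (2 ^ #|A| <= #|F| ^ C)%N ->
  (512 * #|A|.+1 ^ 6 <= #|F|)%N ->
  exists t : nat -> F, forall a, a \in A ->
    (a \in E <-> exists y, y ^+ 2 = \prod_(j < 6 * C) (a + t j)).
Proof.
move=> oddF C0 small big.
pose e := (#|F|./2)%N.
have qE : #|F| = e.*2.+1 by rewrite -[LHS]odd_double_half oddF.
have [h hq qh] := cube_root #|F|.
have hn : (8 * #|A|.+1 ^ 2 <= h)%N.
  rewrite -ltnS -(@ltn_exp2r _ _ 3) //; apply: leq_ltn_trans qh.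
  by apply: leq_trans big; rewrite expnMn -expnM.
have h0 : (0 < h)%N by apply: leq_trans hn; rewrite muln_gt0 expn_gt0.
have n1 : (#|A| + 1 <= #|A|.+1 ^ 2)%N by rewrite -mulnn; nia.
have cond : (2 * h * h * (1 + 2 * #|A|) + #|A| + 2 <= #|F|)%N.
  apply: leq_trans hq; rewrite !expnS expn0 muln1 mulnA.
  have : (h * h * (8 * #|A|.+1) <= h * h * h)%N.
    rewrite leq_mul2l (leq_trans _ hn) ?orbT // leq_mul2l /=; lia.
  have : (#|A| + 2 <= h * h * (#|A| + 2))%N by rewrite leq_pmull ?muln_gt0 ?h0.
  lia.
have e0 : (0 < e)%N by lia.
pose D := [set t : F | [forall (a | a \in A), a + t != 0]].
have Dn0 a t : a \in A -> t \in D -> a + t != 0.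
  by move=> aA; rewrite inE => /forall_inP; apply.
have geD : (#|F| <= 2 * #|D|)%N.
  have le2 : (2 * #|A| <= #|F|)%N.
    apply: leq_trans big; have : (#|A|.+1 <= #|A|.+1 ^ 6)%N by rewrite -{1}[#|A|.+1]expn1 leq_pexp2l.
    lia.
  have ge1 : (#|F| <= #|A| + #|D|)%N by rewrite -leq_subLR; exact: card_avoid_opp.
  lia.
have ltk : (2 ^ #|A| * (#|F| * #|A|.+1 %/ h) ^ (6 * C) < #|D| ^ (6 * C))%N.
  have q0 : (0 < #|F|)%N by rewrite qE.
  rewrite -(@ltn_pmul2r ((2 * h) ^ (6 * C))) ?expn_gt0 ?muln_gt0 ?h0 //.
  rewrite -mulnA -!expnMn.
  apply: (@leq_trans ((#|F| * h) ^ (6 * C))); last first.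
    rewrite leq_exp2r ?muln_gt0 // mulnA leq_mul2r mulnC geD orbT //.
  apply: (@leq_ltn_trans (2 ^ #|A| * (#|F| * (2 * #|A|.+1)) ^ (6 * C))).
    rewrite leq_mul2l leq_exp2r ?muln_gt0 // mulnCA [leqRHS]mulnCA leq_mul2l.
    by rewrite leq_trunc_div !orbT.
  rewrite expnMn mulnCA [ltnRHS]expnMn ltn_pmul2l ?expn_gt0 ?q0 //.
  (* Here 2^|A| <= q^C < (h + 1)^(3C) <= (2h)^(3C). What remains is the 3C-th power of 2h (2(|A| +
     1))^2 <= h^2, which is [hn]. *)
  apply: (@leq_trans ((2 * h) ^ (3 * C) * (2 * #|A|.+1) ^ (6 * C))).
    rewrite ltn_pmul2r ?expn_gt0 //; apply: leq_ltn_trans small _.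
    rewrite expnM ltn_exp2r //; apply: leq_trans qh _.
    by rewrite leq_exp2r //; lia.
  have -> : (6 * C = 2 * (3 * C))%N by lia.
  rewrite !(expnM _ 2) -expnMn leq_exp2r ?muln_gt0 //.
  apply: leq_trans (_ : h * (8 * #|A|.+1 ^ 2) <= _)%N; last by rewrite -mulnn leq_mul2l hn orbT.
  by rewrite -!mulnn; lia.
have hB (B : {set F}) (sBA : B \subset A) (B0 : B != set0) :=
  qchar_sum_bound qE sBA B0 h0 cond.
have [|t tD tE] := @sign_patterns _ _ A E D (fun a t => qchar e (a + t)) _ _ _ hB ltk.
  by move=> a t _ _; rewrite /qchar; case: ifP; auto.
exists (fun j => if insub j is Some i then t i else 0) => a aA.
have -> : \prod_(j < 6 * C) (a + (if insub (val j) is Some i then t i else 0)) =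
    \prod_(j < 6 * C) (a + t j).
  by apply: eq_bigr => j _; rewrite valK.
rewrite tE // -qchar_prod // => [|j _]; last exact: Dn0.
have prod0 : \prod_(j < 6 * C) (a + t j) != 0.
  by apply/prodf_neq0 => j _; apply: Dn0.
exact: iff_sym (rwP (qcharP qE e0 prod0)).
Qed.

(** * Characteristic two: the Artin-Schreier character *)

Definition artin_image (F : finFieldType) : {set F} := [set y ^+ 2 + y | y : F].

(** In characteristic 2 the map y -> y^2 + y is additive with kernel {0, 1}; its image is a subgroup
    of index 2, and this is the additive character with that subgroup as kernel. *)
Definition achar (F : finFieldType) (z : F) : int :=
  if z \in artin_image F then 1 else -1.

Lemma even_card_addrr (F : finFieldType) (z : F) : ~~ odd #|F| -> z + z = 0.
Proof.
move=> evF; have [c pr_c cF] := finPcharP F.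
have: c.-nat #|[set: F]| := abelem_pgroup (fin_ring_pchar_abelem cF).
rewrite cardsT => /p_natP[n nE].
have c2 : c = 2%N.
  have [//|oddc] := even_prime pr_c.
  by have := evF; rewrite nE oddX oddc orbT.
by rewrite c2 in cF; rewrite addrr_pchar2.
Qed.

Lemma artin_imageD (F : finFieldType) (x y : F) : ~~ odd #|F| ->
  x \in artin_image F -> y \in artin_image F -> x + y \in artin_image F.
Proof.
move=> evF /imsetP[u _ ->] /imsetP[v _ ->]; apply/imsetP; exists (u + v) => //.
have uv0 := even_card_addrr (u * v) evF.
by rewrite sqrrD mulr2n uv0 addr0; ring.
Qed.

Lemma card_artin_image (F : finFieldType) :
  ~~ odd #|F| -> (#|artin_image F| * 2)%N = #|F|.
Proof.
move=> evF; rewrite -sum_nat_const -[RHS]sum1_card.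
rewrite [RHS](partition_big (fun y : F => y ^+ 2 + y) (mem (artin_image F))) /=; last first.
  by move=> y _; apply: imset_f.
apply: eq_bigr => _ /imsetP[u _ ->]; rewrite sum1_card.
have uN : u != u + 1 by rewrite -subr_eq0 opprD addrA subrr sub0r oppr_eq0 oner_neq0.
rewrite -[LHS](_ : #|[set u; u + 1]| = _); last by rewrite cards2 uN.
apply: eq_card => y; rewrite !inE -[RHS]subr_eq0.
(* A ring identity; in characteristic 2 the doubled u + 1 vanishes, so the fibre through u is {u, u
   + 1}. *)
have -> : y ^+ 2 + y - (u ^+ 2 + u) = (y - u) * (y - (u + 1) + (u + 1 + (u + 1))) by ring.
by rewrite even_card_addrr // addr0 mulf_eq0 !subr_eq0.
Qed.

(* The image of the Artin-Schreier map has index 2. *)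
Lemma artin_imageC (F : finFieldType) (x y : F) : ~~ odd #|F| ->
  x \notin artin_image F -> y \notin artin_image F -> x + y \in artin_image F.
Proof.
move=> evF xV yV; set V := artin_image F.
have dis : [disjoint V & [set x + v | v in V]].
  rewrite -setI_eq0; apply/eqP/setP => z; rewrite !inE; apply/negP => /andP[zV].
  case/imsetP=> v vV zE; case/negP: xV.
  have -> : x = z + v by rewrite zE -addrA even_card_addrr // addr0.
  exact: artin_imageD.
have cardU : #|V :|: [set x + v | v in V]| = #|F|.
  move: dis; rewrite -leq_card_setU => /eqP ->.
  have -> : #|[set x + v | v in V]| = #|V| by apply: card_imset; apply: addrI.
  by rewrite addnn -muln2 card_artin_image.
have : y \in V :|: [set x + v | v in V].
  have /eqP -> : V :|: [set x + v | v in V] == setT by rewrite eqEcard subsetT cardsT cardU leqnn.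
  by rewrite inE.
rewrite inE (negPf yV) => /imsetP[v vV ->].
by rewrite addrA even_card_addrr // add0r.
Qed.

Lemma acharD (F : finFieldType) (x y : F) : ~~ odd #|F| ->
  achar (x + y) = achar x * achar y.
Proof.
move=> evF; rewrite /achar.
case: (boolP (x \in _)) => xV; case: (boolP (y \in _)) => yV.
- by rewrite artin_imageD.
- case: ifP => // xyV; case/negP: yV.
  by rewrite -[y]add0r -(even_card_addrr x evF) -addrA artin_imageD.
- case: ifP => // xyV; case/negP: xV.
  by rewrite -[x]addr0 -(even_card_addrr y evF) addrA artin_imageD.
- by rewrite artin_imageC.
Qed.

Lemma achar0 (F : finFieldType) : achar (0 : F) = 1.
Proof.
by rewrite /achar ifT //; apply/imsetP; exists 0; rewrite // expr0n addr0.
Qed.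

Lemma achar_sum (F : finFieldType) (I : finType) (P : pred I) (g : I -> F) :
  ~~ odd #|F| ->
  achar (\sum_(i | P i) g i) = \prod_(i | P i) achar (g i).
Proof.
move=> evF; elim/big_rec2: _ => [|i y z Pi <-]; first exact: achar0.
exact: acharD.
Qed.

Lemma sum_achar (F : finFieldType) (c : F) : ~~ odd #|F| ->
  \sum_t achar (t * c) = if c == 0 then #|F|%:Z else 0.
Proof.
move=> evF; case: eqVneq => [->|c0].
  under eq_bigr => t _ do rewrite mulr0 achar0.
  by rewrite sumr_const natz.
have -> : \sum_t achar (t * c) = \sum_(t : F) achar t.
  by rewrite [RHS](reindex_inj (mulIf c0)).
rewrite (bigID (mem (artin_image F))) /=.
rewrite (eq_bigr (fun _ => 1)) => [|t tV]; last by rewrite /achar tV.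
rewrite [X in _ + X](eq_bigr (fun _ => -1)) => [|t tV]; last by rewrite /achar (negPf tV).
rewrite !sumr_const.
have -> : #|[predC artin_image F]| = #|artin_image F|.
  by apply/eqP; rewrite -(eqn_add2l #|artin_image F|) cardC -card_artin_image // muln2 addnn.
by rewrite mulNrn subrr.
Qed.

(** Clearing denominators gives a polynomial [N] of degree below |B|. It is nonzero because at -a0
    only the summand of a0 survives. *)
Lemma card_roots_sum_inv (F : finFieldType) (B D : {set F}) :
  B != set0 -> (forall a s, a \in B -> s \in D -> a + s != 0) ->
  (#|[set s in D | (\sum_(a in B) (a + s)^-1 == 0)%R]| < #|B|)%N.
Proof.
case/set0Pn=> a0 a0B Dn0.
pose N := \sum_(a in B) \prod_(b in B | b != a) ('X - (- b)%:P).
have NE s : N.[s] = \sum_(a in B) \prod_(b in B | b != a) (b + s).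
  rewrite horner_sum; apply: eq_bigr => a _; rewrite horner_prod.
  by apply: eq_bigr => b _; rewrite hornerXsubC opprK addrC.
have N0 : N != 0.
  suff : N.[- a0] != 0 by apply: contraNneq => ->; rewrite horner0.
  rewrite NE (bigD1 a0) //= [X in _ + X]big1 ?addr0 => [|a /andP[aB aN]].
    by apply/prodf_neq0 => b /andP[_ bN]; rewrite subr_eq0.
  by rewrite (bigD1 a0) ?a0B 1?eq_sym //= subrr mul0r.
have szN : (size N <= #|B|)%N.
  apply: leq_trans (size_sum _ _ _) _; apply/bigmax_leqP => a aB.
  rewrite -big_enum_cond -big_filter size_prod_XsubC size_filter.
  rewrite cardE -(count_predC (fun b => b != a)) -addn1 leq_add2l.
  by rewrite -has_count; apply/hasP; exists a; rewrite ?mem_enum //= negbK.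
apply: leq_trans szN; rewrite cardE; apply: max_poly_roots (enum_uniq _) => //.
apply/allP => s; rewrite mem_enum inE => /andP[sD /eqP s0].
rewrite /root NE; apply/eqP.
rewrite (eq_bigr (fun a => (\prod_(b in B) (b + s)) * (a + s)^-1)) => [|a aB].
  by rewrite -big_distrr /= s0 mulr0.
by rewrite [in RHS](bigD1 a) //= mulrAC mulfV ?mul1r ?Dn0.
Qed.

(** Apply [sign_patterns] to pairs (s, t). Summing over t first gives q when sum_{a in B} 1/(a + s)
    = 0 and 0 otherwise, so beta = q|A| against |D| >= q^2/2. The size condition follows from 2^|A|
    (2|A|)^(6C) < q^C q^C. *)
Lemma even_patterns (F : finFieldType) (A E : {set F}) (C : nat) :
  ~~ odd #|F| -> (0 < C)%N -> (2 ^ #|A| <= #|F| ^ C)%N ->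
  (512 * #|A|.+1 ^ 6 <= #|F|)%N ->
  exists s t : nat -> F, forall a, a \in A ->
    (forall j, (j < 6 * C)%N -> a + s j != 0) /\
    (a \in E <-> exists y, y ^+ 2 + y = \sum_(j < 6 * C) t j / (a + s j)).
Proof.
move=> evF C0 small big.
pose D0 := [set s : F | [forall (a | a \in A), a + s != 0]].
pose D := setX D0 [set: F].
have Dn0 a st : a \in A -> st \in D -> a + st.1 != 0.
  by move=> aA; rewrite !inE andbT => /forall_inP; apply.
have geD : (#|F| <= 2 * #|D0|)%N.
  have le2 : (2 * #|A| <= #|F|)%N.
    apply: leq_trans big; have : (#|A|.+1 <= #|A|.+1 ^ 6)%N by rewrite -{1}[#|A|.+1]expn1 leq_pexp2l.
    lia.
  have ge1 : (#|F| <= #|A| + #|D0|)%N by rewrite -leq_subLR; exact: card_avoid_opp.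
  lia.
have q0 : (0 < #|F|)%N by apply: leq_trans big; rewrite muln_gt0 expn_gt0.
have ltk : (2 ^ #|A| * (#|F| * #|A|) ^ (6 * C) < #|D| ^ (6 * C))%N.
  rewrite cardsX cardsT [(#|D0| * _)%N]mulnC !expnMn mulnCA ltn_pmul2l ?expn_gt0 ?q0 //.
  rewrite -(@ltn_pmul2l (2 ^ (6 * C))) ?expn_gt0 // -expnMn.
  apply: (@leq_trans (#|F| ^ (6 * C))); last by rewrite leq_exp2r // muln_gt0.
  rewrite mulnCA -expnMn.
  apply: (@leq_trans (#|F| ^ C * #|F| ^ C)); last by rewrite -expnD leq_pexp2l //; lia.
  apply: (@leq_ltn_trans (#|F| ^ C * (2 * #|A|) ^ (6 * C))).
    by rewrite leq_mul2r small orbT.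
  rewrite ltn_pmul2l ?expn_gt0 ?q0 // expnM ltn_exp2r //.
  apply: leq_trans big; rewrite expnMn.
  apply: (@leq_ltn_trans (512 * #|A| ^ 6)); first by rewrite leq_mul2r orbT.
  by rewrite ltn_pmul2l // ltn_exp2r.
pose h (a : F) (st : F * F) := achar (st.2 / (a + st.1)).
have hB (B : {set F}) : B \subset A -> B != set0 ->
    `|\sum_(st in D) \prod_(a in B) h a st| <= (#|F| * #|A|)%:Z.
  move=> sBA B0.
  have -> : \sum_(st in D) \prod_(a in B) h a st =
      \sum_(s in D0) \sum_t achar (t * \sum_(a in B) (a + s)^-1).
    rewrite pair_big /=; apply: eq_big => [[s t]|[s t] _]; first by rewrite !inE.
    by rewrite big_distrr /= achar_sum.
  under eq_bigr => s _ do rewrite sum_achar //.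
  rewrite -big_mkcondr /= sumr_const -natz -mulrnA natz ger0_norm // lez_nat.
  rewrite leq_mul2l; apply/orP; right.
  apply: leq_trans (subset_leq_card sBA).
  have Dn1 a s : a \in B -> s \in D0 -> a + s != 0.
    by move=> aB; rewrite inE => /forall_inP; apply; apply: (subsetP sBA).
  apply: leq_trans (ltnW (card_roots_sum_inv B0 Dn1)).
  by apply/eq_leq/eq_card => s; rewrite [RHS]inE.
have [|st stD stE] := @sign_patterns _ _ A E D h _ _ _ hB ltk.
  by move=> a t _ _; rewrite /h /achar; case: ifP; auto.
exists (fun j => if insub j is Some i then (st i).1 else 0).
exists (fun j => if insub j is Some i then (st i).2 else 0) => a aA; split.
  by move=> j ltj; rewrite insubT; apply: Dn0.
have -> : \sum_(j < 6 * C) (if insub (val j) is Some i then (st i).2 else 0) /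
     (a + (if insub (val j) is Some i then (st i).1 else 0)) =
    \sum_(j < 6 * C) (st j).2 / (a + (st j).1).
  by apply: eq_bigr => j _; rewrite valK.
rewrite stE // /h -achar_sum // /achar.
set z := \sum_(_ < _) _.
split; first by case: ifP => // /imsetP[y _ ->] _; exists y.
by case=> y yz; rewrite ifT //; apply/imsetP; exists y.
Qed.

(** * Definability in the ultraproduct *)

Fixpoint pt_eval (K : finFieldType) (e : nat -> K) (t : term) : K :=
  match t with
  | TVar n => e n
  | TZero => 0
  | TOne => 1
  | TAdd t1 t2 => pt_eval e t1 + pt_eval e t2
  | TOpp t1 => - pt_eval e t1
  | TMul t1 t2 => pt_eval e t1 * pt_eval e t2
  end.

Definition pt_env (K : finFieldType) (a : K) (c : nat -> K) (v : nat) (y : K) : nat -> K :=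
  fun n => if n == v then y else if n is k.+1 then c k else a.

Lemma tevalE (I : Type) (F : I -> finFieldType) (a y : uprod F)
    (c : nat -> uprod F) (v : nat) (t : term) (i : I) :
  teval (upd (env_of a c) v y) t i =
  pt_eval (pt_env (a i) (fun k => c k i) v (y i)) t.
Proof.
elim: t => //= [n|t1 -> t2 ->|t1 ->|t1 -> t2 ->] //.
by rewrite /upd /pt_env; case: eqP => //; case: n.
Qed.

(** The conjunct [FP] confines x to [A], since the equation is controlled only there. *)
Definition solvability_formula (v : nat) (L R : term) : formula :=
  FAnd (FP (TVar 0)) (FEx v (FEq L R)).

(** The instance of the theorem of Łoś for one existential quantifier over an equation: parameters
    and witnesses are chosen coordinate by coordinate. Where none exists the choice is arbitrary,
    which happens only off a large set. *)
Lemma definable_of_pointwise (I : Type) (F : I -> finFieldType)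
    (U : (I -> Prop) -> Prop) (A : forall i, {set F i}) (v : nat) (L R : term) :
  is_ultrafilter U -> (0 < v)%N ->
  U (fun i => forall E : {set F i}, exists c : nat -> F i, forall a, a \in A i ->
       (a \in E <-> exists y, pt_eval (pt_env a c v y) L = pt_eval (pt_env a c v y) R)) ->
  forall E : forall i, {set F i}, internal_subset U E A ->
  exists c : nat -> uprod F, forall a : uprod F,
    uin U E a <-> sat U A (env_of a c) (solvability_formula v L R).
Proof.
case=> _ _ Uup UI _ v0 HU E sEA.
pose good i (c : nat -> F i) := forall a, a \in A i ->
  (a \in E i <-> exists y, pt_eval (pt_env a c v y) L = pt_eval (pt_env a c v y) R).
pose c0 i := epsilon (inhabits (fun _ : nat => 0 : F i)) (@good i).
have c0P : U (fun i => good i (c0 i)).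
  by apply: Uup HU _ => i /(_ (E i)); apply: epsilon_spec.
exists (fun k i => c0 i k) => a; split=> [Ea|[/= Aa [y yP]]].
  have Aa := sEA a Ea; split=> //.
  pose sol i y := pt_eval (pt_env (a i) (c0 i) v y) L = pt_eval (pt_env (a i) (c0 i) v y) R.
  exists (fun i => epsilon (inhabits 0) (sol i)).
  apply: Uup (UI _ _ c0P (UI _ _ Aa Ea)) _ => i [gi [Ai Ei]].
  rewrite !tevalE.
  exact: (epsilon_spec (inhabits (0 : F i)) (sol i) ((gi _ Ai).1 Ei)).
apply: Uup (UI _ _ c0P (UI _ _ Aa yP)) _ => i [gi [Ai]].
by rewrite !tevalE => yi; apply/gi => //; exists (y i).
Qed.

Fixpoint shift_prod (s : nat -> nat) (k : nat) : term :=
  if k is j.+1 then TMul (shift_prod s j) (TAdd (TVar 0) (TVar (s j))) else TOne.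

(* The numerator of [sum_j t_j / (x + s_j)] over the common denominator
   [shift_prod s k]: the language has no division. *)
Fixpoint shift_numer (s t : nat -> nat) (k : nat) : term :=
  if k is j.+1 then
    TAdd (TMul (shift_numer s t j) (TAdd (TVar 0) (TVar (s j))))
         (TMul (TVar (t j)) (shift_prod s j))
  else TZero.

Lemma shift_prodE (K : finFieldType) (e : nat -> K) (s : nat -> nat) (k : nat) :
  pt_eval e (shift_prod s k) = \prod_(j < k) (e 0%N + e (s j)).
Proof. by elim: k => [|k IHk] /=; rewrite ?big_ord0 // big_ord_recr IHk. Qed.

Lemma shift_numerE (K : finFieldType) (e : nat -> K) (s t : nat -> nat) (k : nat) :
  (forall j, (j < k)%N -> e 0%N + e (s j) != 0) ->
  pt_eval e (shift_numer s t k) =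
  pt_eval e (shift_prod s k) * \sum_(j < k) e (t j) / (e 0%N + e (s j)).
Proof.
elim: k => [|k IHk] nz /=; first by rewrite big_ord0 mulr0.
rewrite IHk => [|j ltj]; last by apply: nz; apply: ltnW.
rewrite big_ord_recr /=; have := nz k (ltnSn k).
by move: (pt_eval _ _) (\sum_(_ < _) _) => p S nzk; field.
Qed.

(** * Growth estimates and large sets of indices *)

Lemma exp_dominates (M K : nat) :
  exists N, forall n, (N <= n)%N -> (M * n.+1 ^ K <= 2 ^ n)%N.
Proof.
(* With m the quotient of n by K + 1, this threshold gives m >= M (K+1)^K. Then M (n+1)^K <=
   (m+1)^(K+1) <= 2^(m(K+1)) <= 2^n, using n + 1 <= (K+1)(m+1) and m + 1 <= 2^m. *)
exists (M * K.+1 ^ K * K.+1)%N => n leNn.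
pose m := (n %/ K.+1)%N.
have lem : (M * K.+1 ^ K <= m)%N by rewrite leq_divRL.
have lemn : (m * K.+1 <= n)%N by apply: leq_trunc_div.
have len : (n.+1 <= K.+1 * m.+1)%N.
  by rewrite mulnC; apply: ltn_ceil.
apply: (@leq_trans (m.+1 ^ K.+1)).
  apply: (@leq_trans (M * (K.+1 * m.+1) ^ K)).
    rewrite leq_mul2l; apply/orP; right.
    by case: (posnP K) => [->|K0]; rewrite ?expn0 // leq_exp2r.
  rewrite expnMn mulnA expnS leq_mul2r; apply/orP; right.
  exact: leqW.
apply: leq_trans (_ : 2 ^ (m * K.+1) <= _)%N; last by rewrite leq_exp2l.
by rewrite expnM leq_exp2r // ltn_expl.
Qed.

Lemma INR_expn (m n : nat) : INR (m ^ n) = pow (INR m) n.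
Proof. by elim: n => [|n IHn] //; rewrite expnS mult_INR IHn. Qed.

Lemma exp2_le_of_log (n q C' : nat) (C : R) :
  (0 < q)%N -> Rle C (INR C') -> Rle (INR n) (Rmult C (log2R q)) ->
  (2 ^ n <= q ^ C')%N.
Proof.
move=> q0 leC le_n; rewrite leqNgt; apply/negP => lt2.
have q1 : Rle (IZR 1) (INR q) by rewrite -[IZR 1]/(INR 1); apply/le_INR/ssrnat.leP.
have lnq : Rle (IZR 0) (ln (INR q)).
  by case: q1 => [lt1|<-]; rewrite ?ln_1; [left; rewrite -ln_1; apply: ln_increasing; lra | lra].
have ln2 : Rlt (IZR 0) (ln (INR 2)).
  by rewrite -ln_1; apply: ln_increasing; [lra | rewrite /=; lra].
have : Rlt (ln (INR (q ^ C'))) (ln (INR (2 ^ n))).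
  apply: ln_increasing; last by apply/lt_INR/ssrnat.ltP.
  by apply/lt_0_INR/ssrnat.ltP; rewrite expn_gt0 q0.
rewrite !INR_expn !ln_pow; [|rewrite /=; lra|lra].
apply: Rle_not_lt.
have le_n' : Rle (INR n) (Rmult (INR C') (log2R q)).
  apply: Rle_trans le_n _; apply: Rmult_le_compat_r => //.
  by apply: Rle_mult_inv_pos.
apply: (Rmult_le_reg_r (Rinv (ln (INR 2)))); first exact: Rinv_0_lt_compat.
rewrite Rmult_assoc Rinv_r; last lra.
by rewrite Rmult_1_r Rmult_assoc.
Qed.

Lemma ultrafilter_pigeonhole (I : Type) (U : (I -> Prop) -> Prop)
    (N : nat) (P : nat -> I -> Prop) :
  is_ultrafilter U -> U (fun i => exists2 k, (k < N)%N & P k i) ->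
  exists2 k, (k < N)%N & U (P k).
Proof.
case=> _ U0 Uup UI Uor; elim: N => [|N IHN] UN.
  by case: U0; apply: Uup UN _ => i [].
case: (Uor (P N)) => [UP|UnP]; first by exists N.
have [|k ltk UPk] := IHN; last by exists k => //; apply: ltnW.
apply: Uup (UI _ _ UN UnP) _ => i [[k]]; rewrite ltnS leq_eqVlt.
by case/predU1P=> [->|ltk] Pk nP //; exists k.
Qed.

(** If |A_i| < N on a large set, the N sections sending i to the k-th element of A_i exhaust A, by
    [ultrafilter_pigeonhole]. *)
Lemma internal_infinite_card (I : Type) (F : I -> finFieldType)
    (U : (I -> Prop) -> Prop) (A : forall i, {set F i}) (N : nat) :
  is_ultrafilter U -> internal_infinite U A -> U (fun i => (N <= #|A i|)%N).
Proof.
move=> hU infA; case: (hU) => _ _ Uup UI Uor.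
case: (Uor (fun i => (N <= #|A i|)%N)) => // Usmall; case: infA.
exists N, (fun k i => nth 0 (enum (A i)) k) => a Aa.
have [|k ltk Uk] := @ultrafilter_pigeonhole I U N (fun k i => a i = nth 0 (enum (A i)) k) hU.
  apply: Uup (UI _ _ Usmall Aa) _ => i [/negP small aA].
  exists (index (a i) (enum (A i))); last by rewrite nth_index ?mem_enum.
  apply: leq_trans (_ : #|A i| <= N)%N; last by apply: ltnW; rewrite ltnNge.
  by rewrite cardE index_mem mem_enum.
by exists k.
Qed.

Theorem theorem4p3 (I : Type) (F : I -> finFieldType)
    (U : (I -> Prop) -> Prop)
    (hU : is_ultrafilter U) (hnp : nonprincipal U)
    (A : forall i, {set F i})
    (hAinf : internal_infinite U A)
    (C : R) (hC : Rlt R0 C)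
    (hsmall : U (fun i => Rle (INR #|A i|) (Rmult C (log2R #|F i|)))) :
  exists theta : formula,
    forall E : forall i, {set F i},
      internal_subset U E A ->
      exists c : nat -> uprod F,
        forall a : uprod F,
          uin U E a <-> sat U A (env_of a c) theta.
Proof.
have [C' ltC] := INR_unbounded C.
have C'0 : (0 < C')%N.
  by case: C' ltC => // ltC; move: ltC; rewrite /=; lra.
(* For n >= N this yields (512 (n+1)^6)^C' <= 2^n <= q^C', and taking C'-th roots gives the second
   bound of [Ubig]. *)
have [N domN] := exp_dominates (512 ^ C') (6 * C').
case: (hU) => _ _ Uup UI Uor.
have Ubig : U (fun i => (2 ^ #|A i| <= #|F i| ^ C')%N /\ (512 * #|A i|.+1 ^ 6 <= #|F i|)%N).
  apply: Uup (UI _ _ hsmall (internal_infinite_card N hU hAinf)) _ => i [le_log geN].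
  have le2 : (2 ^ #|A i| <= #|F i| ^ C')%N.
    apply: exp2_le_of_log le_log; last exact: Rlt_le.
    exact: ltn_trans (finNzRing_gt1 (F i)).
  split=> //; rewrite -(@leq_exp2r _ _ C') // expnMn -expnM.
  exact: leq_trans (domN _ geN) le2.
pose k := (6 * C')%N.
(* The ultrafilter decides the parity of q, hence which formula is used; neither formula depends on
   [E]. *)
case: (Uor (fun i => odd #|F i|)) => [Uodd|Ueven].
- exists (solvability_formula k.+1 (TMul (TVar k.+1) (TVar k.+1)) (shift_prod S k)).
  apply: definable_of_pointwise => //; apply: Uup (UI _ _ Uodd Ubig) _ => i [oddF [small big]] E.
  have [t tP] := odd_patterns E oddF C'0 small big.
  exists t => a aA; rewrite tP //.
  have envE y : pt_eval (pt_env a t k.+1 y) (shift_prod S k) = \prod_(j < k) (a + t j).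
    rewrite shift_prodE; apply: eq_bigr => j _.
    by rewrite /pt_env /= eqSS ltn_eqF.
  by split=> -[y yP]; exists y; move: yP; rewrite envE /= /pt_env eqxx expr2.
(* Variable 0 is x; the s_j take the odd variables and the t_j the positive even ones, all below the
   bound variable 2k + 1. *)
pose s j := (j.*2).+1; pose t j := (j.*2).+2; pose v := (k.*2).+1.
(* With P the common denominator and Q the sum of fractions, the equation reads v^2 + vP = P(PQ);
   the substitution v = yP turns it into y^2 + y = Q. *)
exists (solvability_formula v
  (TAdd (TMul (TVar v) (TVar v)) (TMul (TVar v) (shift_prod s k)))
  (TMul (shift_prod s k) (shift_numer s t k))).
apply: definable_of_pointwise => //; apply: Uup (UI _ _ Ueven Ubig) _ => i [/negP evF [small big]] E.
have [s0 [t0 stP]] := even_patterns E evF C'0 small big.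
(* Variable n + 1 receives [c n], so parity is reversed: even n carries an s_j and odd n a t_j. *)
pose c n := if odd n then t0 n./2 else s0 n./2.
exists c => a aA.
have [nz ->] := stP a aA.
have env0 y : pt_env a c v y 0%N = a by [].
have envv y : pt_env a c v y v = y by rewrite /pt_env eqxx.
have envs y j : (j < k)%N -> pt_env a c v y (s j) = s0 j.
  by move=> ltj; rewrite /pt_env /s /v eqSS ltn_eqF ?ltn_double // /c odd_double doubleK.
have envt y j : (j < k)%N -> pt_env a c v y (t j) = t0 j.
  move=> ltj; rewrite /pt_env /t /v eqSS ltn_eqF; last by lia.
  by rewrite /c /= odd_double /= uphalf_double.
pose P := \prod_(j < k) (a + s0 j).
pose Q := \sum_(j < k) t0 j / (a + s0 j).
have prodE y : pt_eval (pt_env a c v y) (shift_prod s k) = P.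
  by rewrite shift_prodE; apply: eq_bigr => j _; rewrite env0 envs.
have numE y : pt_eval (pt_env a c v y) (shift_numer s t k) = P * Q.
  rewrite shift_numerE => [|j ltj]; last by rewrite env0 envs ?nz.
  by rewrite prodE; congr (_ * _); apply: eq_bigr => j _; rewrite env0 envs ?envt.
have P0 : P != 0 by apply/prodf_neq0 => j _; apply: nz.
split=> -[y yP].
  exists (y * P); rewrite /= prodE numE envv.
  by rewrite -/Q in yP; rewrite -yP; ring.
exists (y / P); move: yP; rewrite /= prodE numE envv -/Q => yP.
have -> : Q = (P * (P * Q)) / P ^+ 2 by field.
by rewrite -yP; field.
Qed.
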